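(* For every distribution $\mu$ on $\{0,1\}^N$, where $N$ is a perfect square, we have $$Q_{WE}^\mu(AO)=O\left(\sqrt{N\log N}\right)$$ as $N\to\infty$, with the implicit constant independent of $N$ and $\mu$. Here $AO:\{0,1\}^N\to\{0,1\}$ is the 2-level AND-OR tree on $N$ variables.
   Context: The 2-level AND-OR tree $AO$ on $N$ bits is the AND of $\sqrt N$ ORs, each OR acting on its own block of $\sqrt N$ variables (the blocks are disjoint and together partition the $N$ input variables). Quantum query model. The input $x\in\{0,1\}^N$ is accessed through the unitary $O=O_x$ acting on basis states by $O|i,b,z\rangle=|i,b\oplus x_i,z\rangle$, with $i\in\{1,\dots,N\}$, $b\in\{0,1\}$ and $z$ a workspace of finitely many qubits. A $T$-query quantum algorithm is $A=U_TOU_{T-1}O\cdots U_1OU_0$, with each $U_j$ a fixed unitary independent of $x$; it starts in the all-zero state, and its output is obtained by measuring the rightmost bit of the final state. $P_A(x)$ denotes the probability that $A$ outputs $1$ on input $x$. For $f:\{0,1\}^N\to\{0,1\}$ and a probability distribution $\mu$ on $\{0,1\}^N$, an algorithm $A$ is weakly $\frac23$-exact for $f$ with respect to $\mu$ if $\mu(\{x: P_A(x)=f(x)\})\ge\frac23$. $Q_{WE}^\mu(f)$ is the minimal number of queries of a weakly $\frac23$-exact algorithm for $f$ with respect to $\mu$. *)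

(* Defs.v *)
From HB Require Import structures.
From mathcomp Require Import all_boot all_order all_algebra.
From mathcomp Require Import complex.
From mathcomp Require Import all_classical all_reals all_analysis.

Set Implicit Arguments.
Unset Strict Implicit.
Unset Printing Implicit Defensive.

Import Order.TTheory GRing.Theory Num.Theory.
Local Open Scope ring_scope.

Notation input N := {ffun 'I_N -> bool}.

(* The triple [(i, b, z)] stands for the basis state |i,b,z>, where [z] is a
   workspace of [w] qubits. Query indices are numbered from 0. *)
Notation basis N w := ('I_N * bool * w.-tuple bool)%type.

(* Matrices and vectors over [basis N w] are indexed by ordinals through
   [enum_val]; operators act on column vectors. *)
Notation dim N w := #|{: basis N w}|.

Definition query_map N w (x : input N) (s : basis N w) : basis N w :=
  (s.1.1, s.1.2 (+) x s.1.1, s.2).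

(* The rightmost bit of |i,b,z> is [b] when the workspace is empty. *)
Definition rightmost_bit N w (s : basis N w) : bool := last s.1.2 s.2.

Definition is_zero_state N w (s : basis N w) : bool :=
  [&& nat_of_ord s.1.1 == 0%N, ~~ s.1.2 & all negb s.2].

Section QuantumQuery.
Variable R : realType.

Definition oracle_mx N w (x : input N) : 'M[R[i]]_(dim N w) :=
  \matrix_(s, t) (enum_val s == query_map x (enum_val t))%:R.

Definition zero_state N w : 'cV[R[i]]_(dim N w) :=
  \col_s (is_zero_state (enum_val s))%:R.

(* [gate0 A] is U_0, and [gates A] lists U_1, ..., U_T in this order. *)
Record algorithm (N T : nat) := Algorithm {
  workspace : nat;
  gate0 : 'M[R[i]]_(dim N workspace);
  gates : T.-tuple 'M[R[i]]_(dim N workspace);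
  gate0_unitary : gate0 \is unitarymx;
  gates_unitary : forall j : 'I_T, tnth gates j \is unitarymx }.

Definition final_state N T (A : algorithm N T) (x : input N) :
    'cV[R[i]]_(dim N (workspace A)) :=
  foldl (fun v U => U *m (oracle_mx (workspace A) x *m v))
        (gate0 A *m zero_state N (workspace A)) (gates A).

Definition prob_accept N T (A : algorithm N T) (x : input N) : R :=
  \sum_(s | rightmost_bit (enum_val s))
     ComplexField.Normc.normc (final_state A x s 0) ^+ 2.

Definition is_distribution N (mu : input N -> R) : Prop :=
  (forall x, 0 <= mu x) /\ \sum_x mu x = 1.

Definition weakly_exact N T (A : algorithm N T) (mu : input N -> R)
    (f : input N -> bool) : Prop :=
  2 / 3 <= \sum_(x | prob_accept A x == (f x)%:R) mu x.

(* The minimum is taken in the extended reals: it would be [+oo] if there were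
   no weakly exact algorithm, and it is attained otherwise. *)
Definition QWE N (mu : input N -> R) (f : input N -> bool) : \bar R :=
  ereal_inf [set ((T%:R : R)%:E) | T in
    [set T : nat | exists A : algorithm N T, weakly_exact A mu f]]%classic.

End QuantumQuery.

(* The AND-OR tree on N = m ^ 2 bits; the blocks are the [m] consecutive runs
   of [m] variables, block [j] consisting of the [i] with [i %/ m = j]. *)
Definition AO (m : nat) (x : input (m ^ 2)) : bool :=
  [forall j : 'I_m, [exists i : 'I_(m ^ 2), (i %/ m == j)%N && x i]].

(* Main.v *)
(* A state family x |-> psi_x is studied only through its Gram kernel
   k(x, x') = <psi_x, psi_x'>.  Unitaries independent of x do not change the
   kernel, and conversely two finite families with the same kernel are related
   by a unitary; so a T-query algorithm amounts to a chain of T transformations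
   k0 + sum_i k_i |-> k0 + sum_i (-1)^(x_i + x'_i) k_i of positive kernels, and
   it is only required to be exact on a set X of good inputs.

   Grover search with a known number t of marked items among s is exact with
   O(sqrt(s / t)) queries.  For a given weight on the sets of marked items, a
   list of such searches of total cost O(sqrt(n L)) handles all sets except a
   fraction 2^-L of the weight: sizes up to L are tried one by one, and for
   larger sizes random pools of items contain exactly one marked item with
   constant probability, so suitable pools can be fixed greedily.

   For the AND-OR tree the inner ORs use L ~ log N, so that all blocks are
   handled at once for most inputs; on those, each OR is computed exactly, can
   be uncomputed, and serves as the oracle of an outer search, with constant L,
   for a block equal to zero. *)
Require Import Defs.
From mathcomp Require Import all_boot all_order all_algebra.
From mathcomp Require Import complex.
From mathcomp Require Import ring lra zify.
From mathcomp Require Import all_classical all_reals all_analysis.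

Import Order.TTheory GRing.Theory Num.Theory.
Import numFieldNormedType.Exports.
(* [basis] and [dim] are otherwise hidden by library names. *)
Import Defs.
Local Open Scope ring_scope.

Set Implicit Arguments.
Unset Strict Implicit.
Unset Printing Implicit Defensive.

(** * Gram kernels under queries *)

Section Kernels.
Context {R : realType} {N : nat} {X : Type} (inp : X -> input N).
Implicit Types (k g a r : X -> X -> R) (y : X -> bool) (T : nat).

(** Each member of [vs] is one real coordinate of the state family in an orthonormal basis; complex
    amplitudes never occur. *)
Definition gram k :=
  exists vs : seq (X -> R), forall x x', k x x' = \sum_(v <- vs) v x * v x'.

Lemma gram_ext k1 k2 : k1 =2 k2 -> gram k1 -> gram k2.
Proof. by move=> e [vs h]; exists vs => x x'; rewrite -e. Qed.

Lemma gram_rank1 (v : X -> R) : gram (fun x x' => v x * v x').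
Proof. by exists [:: v] => x x'; rewrite big_seq1. Qed.

Lemma gram0 : gram (fun _ _ => 0).
Proof. by exists [::] => x x'; rewrite big_nil. Qed.

Lemma gram_cst c : 0 <= c -> gram (fun _ _ => c).
Proof.
move=> c0; apply: gram_ext (gram_rank1 (fun _ => Num.sqrt c)) => x x' /=.
by rewrite -expr2 sqr_sqrtr.
Qed.

Lemma gramD k1 k2 : gram k1 -> gram k2 -> gram (fun x x' => k1 x x' + k2 x x').
Proof.
move=> [v1 h1] [v2 h2]; exists (v1 ++ v2) => x x'.
by rewrite big_cat /= -h1 -h2.
Qed.

(** Tensor product of the two state families. *)
Lemma gramM k1 k2 : gram k1 -> gram k2 -> gram (fun x x' => k1 x x' * k2 x x').
Proof.
move=> [v1 h1] [v2 h2].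
exists [seq (fun x => v x * w x) | v <- v1, w <- v2] => x x'.
rewrite h1 h2 big_distrl big_allpairs_dep /=; apply: eq_bigr => v _.
by rewrite big_distrr; apply: eq_bigr => w _ /=; rewrite mulrACA.
Qed.

Lemma gram_sum I (s : seq I) (k : I -> X -> X -> R) :
  (forall i, gram (k i)) -> gram (fun x x' => \sum_(i <- s) k i x x').
Proof.
move=> h; elim: s => [|i s IH].
  by apply: gram_ext gram0 => x x'; rewrite big_nil.
by apply: gram_ext (gramD (h i) IH) => x x'; rewrite big_cons.
Qed.

Definition phase y (x x' : X) : R := (-1) ^+ y x * (-1) ^+ y x'.

Lemma gram_phase y : gram (phase y).
Proof. exact: gram_rank1. Qed.

Lemma phaseK y x x' : phase y x x' * phase y x x' = 1.
Proof. by rewrite /phase mulrACA -!expr2 !sqrr_sign mulr1. Qed.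

(* [k0] and [ki i] are the Gram kernels of the parts of the state on which the
   query acts trivially, resp. by the phase (-1)^(x_i). *)
Definition query_step k k' :=
  exists (k0 : X -> X -> R) (ki : 'I_N -> X -> X -> R),
    [/\ gram k0, forall i, gram (ki i),
        forall x x', k x x' = k0 x x' + \sum_i ki i x x' &
        forall x x', k' x x' =
          k0 x x' + \sum_i ki i x x' * phase (fun x => inp x i) x x'].

Fixpoint queries T k k' : Prop :=
  if T is T'.+1 then exists2 k1, query_step k k1 & queries T' k1 k'
  else k =2 k'.

Lemma query_step_idle k : gram k -> query_step k k.
Proof.
move=> hk; exists k, (fun _ _ _ => 0); split=> // [_|x x'|x x']; first exact: gram0.
  by rewrite big1 ?addr0.
by rewrite big1 ?addr0 // => i _; rewrite mul0r.
Qed.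

Lemma query_stepC k k' : query_step k k' -> query_step k' k.
Proof.
move=> [k0 [ki [h0 hi e e']]].
exists k0, (fun i x x' => ki i x x' * phase (fun x => inp x i) x x'); split=> //.
  by move=> i; apply: gramM => //; apply: gram_phase.
by move=> x x'; rewrite e; congr (_ + _); apply: eq_bigr => i _; rewrite -mulrA phaseK mulr1.
Qed.

Lemma query_stepD k1 k1' k2 k2' : query_step k1 k1' -> query_step k2 k2' ->
  query_step (fun x x' => k1 x x' + k2 x x') (fun x x' => k1' x x' + k2' x x').
Proof.
move=> [k0 [ki [h0 hi e e']]] [l0 [li [h0' hi' f f']]].
exists (fun x x' => k0 x x' + l0 x x'), (fun i x x' => ki i x x' + li i x x').
split=> [|i|x x'|x x']; [exact: gramD|exact: gramD| |].
  by rewrite e f big_split /= addrACA.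
rewrite e' f' addrACA; congr (_ + _); rewrite -big_split /=.
by apply: eq_bigr => i _; rewrite mulrDl.
Qed.

(** A register with kernel [g] is carried along untouched by the query. *)
Lemma query_stepM g k k' : gram g -> query_step k k' ->
  query_step (fun x x' => g x x' * k x x') (fun x x' => g x x' * k' x x').
Proof.
move=> hg [k0 [ki [h0 hi e e']]].
exists (fun x x' => g x x' * k0 x x'), (fun i x x' => g x x' * ki i x x').
split=> [|i|x x'|x x']; [exact: gramM|exact: gramM| |].
  by rewrite e mulrDr big_distrr.
rewrite e' mulrDr big_distrr; congr (_ + _).
by apply: eq_bigr => i _; rewrite /= mulrA.
Qed.

Lemma query_step_gram k k' : query_step k k' -> gram k'.
Proof.
move=> [k0 [ki [h0 hi e e']]].
have h : gram (fun x x' => \sum_i ki i x x' * phase (fun x => inp x i) x x').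
  by apply: gram_sum => i; apply: gramM => //; apply: gram_phase.
by apply: gram_ext (gramD h0 h) => x x'; rewrite e'.
Qed.

Lemma funext2 k k' : k =2 k' -> k = k'.
Proof. by move=> h; apply/funext => x; apply/funext => x'. Qed.

Lemma queries_ext T k1 k2 k1' k2' : k1 =2 k1' -> k2 =2 k2' ->
  queries T k1 k2 -> queries T k1' k2'.
Proof. by move=> /funext2 -> /funext2 ->. Qed.

Lemma queries_trans T T' k1 k2 k3 :
  queries T k1 k2 -> queries T' k2 k3 -> queries (T + T') k1 k3.
Proof.
elim: T k1 => [|T IH] k1 /=; first by move=> /funext2 ->.
by move=> [k s h] h'; exists k => //; apply: IH.
Qed.

Lemma queriesC T k k' : queries T k k' -> queries T k' k.
Proof.
elim: T k => [|T IH] k /=; first by move=> h x x'; rewrite h.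
move=> [k1 s /IH h]; change (queries T.+1 k' k); rewrite -addn1; apply: queries_trans h _.
by exists k => //; apply: query_stepC.
Qed.

Lemma queries_idle T k : gram k -> queries T k k.
Proof. by move=> h; elim: T => [|T IH] //=; exists k => //; apply: query_step_idle. Qed.

Lemma queries_gram T k k' : gram k -> queries T k k' -> gram k'.
Proof.
elim: T k => [|T IH] k h /=; first by move=> /funext2 <-.
by move=> [k1 /query_step_gram h1 /IH]; apply.
Qed.

Lemma queriesD T k1 k1' k2 k2' : queries T k1 k1' -> queries T k2 k2' ->
  queries T (fun x x' => k1 x x' + k2 x x') (fun x x' => k1' x x' + k2' x x').
Proof.
elim: T k1 k2 => [|T IH] k1 k2 /=; first by move=> h1 h2 x x'; rewrite h1 h2.
move=> [l1 s1 h1] [l2 s2 h2]; exists (fun x x' => l1 x x' + l2 x x').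
  exact: query_stepD.
exact: IH.
Qed.

Lemma queriesM T g k k' : gram g -> queries T k k' ->
  queries T (fun x x' => g x x' * k x x') (fun x x' => g x x' * k' x x').
Proof.
move=> hg; elim: T k => [|T IH] k /=; first by move=> h x x'; rewrite h.
move=> [l s h]; exists (fun x x' => g x x' * l x x'); first exact: query_stepM.
exact: IH.
Qed.

Lemma queries_sum T I (s : seq I) (k k' : I -> X -> X -> R) :
  (forall i, queries T (k i) (k' i)) ->
  queries T (fun x x' => \sum_(i <- s) k i x x')
            (fun x x' => \sum_(i <- s) k' i x x').
Proof.
move=> h; elim: s => [|i s IH].
  by apply: queries_ext (queries_idle T gram0) => x x'; rewrite big_nil.
by apply: queries_ext (queriesD (h i) IH) => x x'; rewrite big_cons.
Qed.

Definition one_kernel (x x' : X) : R := 1.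

Lemma gram1 : gram one_kernel.
Proof. exact: gram_cst. Qed.

(** A phase oracle for [y] costing [T] queries; [flipsM] applies it to an arbitrary state. *)
Definition flips T y := queries T one_kernel (phase y).

Lemma flips_input i : flips 1 (fun x => inp x i).
Proof.
exists (phase (fun x => inp x i)) => //.
exists (fun _ _ => 0), (fun j _ _ => (j == i)%:R); split=> [|j|x x'|x x'].
- exact: gram0.
- by apply: gram_cst.
- by rewrite add0r (bigD1 i) //= eqxx big1 ?addr0 // => j /negPf ->.
- rewrite add0r (bigD1 i) //= eqxx mul1r big1 ?addr0 // => j /negPf ->.
  by rewrite mul0r.
Qed.

Lemma flipsM T y g : gram g -> flips T y ->
  queries T g (fun x x' => g x x' * phase y x x').
Proof.
move=> hg h; apply: queries_ext (queriesM hg h) => x x' //.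
by rewrite /one_kernel mulr1.
Qed.

Lemma flips_const T : flips T (fun _ => false).
Proof.
apply: queries_ext (queries_idle T gram1) => x x' //.
by rewrite /phase !expr0 mulr1.
Qed.

Lemma flips_neg T y : flips T y -> flips T (fun x => ~~ y x).
Proof.
apply: queries_ext => // x x'; rewrite /phase.
by case: (y x); case: (y x'); rewrite /= !expr0 !expr1 ?mulr1 ?mul1r ?mulN1r ?opprK.
Qed.

Definition agree y (x x' : X) : R := (y x == y x')%:R.

(* Query [y] coherently with a control qubit in the state |+>. *)
Lemma flips_agree T y g : gram g -> flips T y ->
  queries T g (fun x x' => g x x' * agree y x x').
Proof.
move=> hg h.
have h2 : gram (fun x x' => g x x' * 2^-1).
  by apply: gramM hg (gram_cst _); rewrite invr_ge0.
apply: queries_ext (queriesD (queries_idle T h2) (flipsM h2 h)) => x x'.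
  by rewrite -mulrDr -[2^-1]mul1r -mulrDl divff ?mulr1 // pnatr_eq0.
rewrite /phase /agree -mulrA -mulrDr; congr (_ * _).
case: (y x); case: (y x'); rewrite /= ?expr0 ?expr1; lra.
Qed.

(** Final states for different values of [y] are orthogonal, so a measurement reads off [y] with
    certainty. *)
Definition computes T y :=
  exists2 k, queries T one_kernel k & forall x x', y x != y x' -> k x x' = 0.

(* Uncomputing: the final kernel [k] satisfies [k = k * phase y]. *)
Lemma computes_flips T y : computes T y -> flips T.*2 y.
Proof.
move=> [k h hk].
have h' : queries T (fun x x' => phase y x x' * k x x') (phase y).
  apply: queries_ext (queriesM (gram_phase y) (queriesC h)) => x x' //.
  by rewrite /one_kernel mulr1.
rewrite /flips -addnn; apply: queries_trans h _; apply: queries_ext h' => x x' //.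
have [e|/hk ->] := eqVneq (y x) (y x'); last by rewrite mulr0.
by rewrite /phase e -expr2 sqrr_sign mul1r.
Qed.

(* The state after [T] queries splits into an accepting part, present only
   when [y] holds, and a rejecting part, absent on [G]. *)
Definition onesided T y (G : X -> bool) :=
  exists a r, [/\ gram a, gram r,
    queries T one_kernel (fun x x' => a x x' + r x x'),
    forall x x', ~~ (y x && y x') -> a x x' = 0 &
    forall x x', G x || G x' -> r x x' = 0].

Lemma onesided0 y : onesided 0 y (fun _ => false).
Proof.
exists (fun _ _ => 0), one_kernel; split=> //; [exact: gram0|exact: gram1|].
by move=> x x'; rewrite add0r.
Qed.

(** The two procedures run in turn on separate registers; the combination accepts when at least one
    of them does. *)
Lemma onesidedD T1 T2 y G1 G2 : onesided T1 y G1 -> onesided T2 y G2 ->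
  onesided (T1 + T2) y (fun x => G1 x || G2 x).
Proof.
move=> [a1 [r1 [ga1 gr1 h1 ha1 hr1]]] [a2 [r2 [ga2 gr2 h2 ha2 hr2]]].
exists (fun x x' => a1 x x' * (a2 x x' + r2 x x') + r1 x x' * a2 x x').
exists (fun x x' => r1 x x' * r2 x x'); split.
- by do ![apply: gramD|apply: gramM].
- exact: gramM.
- apply: queries_trans h1 _.
  apply: queries_ext (queriesM (gramD ga1 gr1) h2) => x x'.
    by rewrite /one_kernel mulr1.
  by rewrite mulrDl [r1 x x' * (_ + _)]mulrDr addrA.
- by move=> x x' h; rewrite ha1 // ha2 // mul0r mulr0 addr0.
- move=> x x'; rewrite orbACA => /orP [] h; first by rewrite hr1 // mul0r.
  by rewrite hr2 // mulr0.
Qed.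

(** If [y] separates two inputs, the accepting part vanishes because it needs [y] on both, and the
    rejecting part because one of the two lies in [G]. *)
Lemma onesided_computes T y G : onesided T y G -> (forall x, y x -> G x) ->
  computes T y.
Proof.
move=> [a [r [_ _ h ha hr]]] hG; eexists; first exact: h.
move=> x x' ne /=; rewrite ha ?hr ?addr0 //.
  by case: (boolP (y x)) ne => [/hG -> //|_]; case: (boolP (y x')) => // /hG ->; rewrite orbT.
by apply: contra ne => /andP[-> ->].
Qed.

End Kernels.

(** * Exact search *)

Section Grover.
Context {R : realType} {N : nat} {X : Type} (inp : X -> input N).
Context {I : finType} (w : I -> R) (y : I -> X -> bool) (T : nat).
Context (w_ge0 : forall i, 0 <= w i) (w_sum1 : \sum_i w i = 1).
Context (y_flips : forall i, flips (R := R) inp T (y i)).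

(* The amplitude of item [i] is [sqrt (w i)] times the first component if [i]
   is marked, and times the second one otherwise. *)
Fixpoint grover j x : R * R :=
  if j is j'.+1 then
    let p := grover j' x in
    let c := \sum_i w i * (if y i x then - p.1 else p.2) in
    (2 * c + p.1, 2 * c - p.2)
  else (1, 1).

Definition grover_amp j i x := if y i x then (grover j x).1 else (grover j x).2.

Definition grover_kernel j x x' :=
  \sum_i w i * (grover_amp j i x * grover_amp j i x').

Lemma gram_grover_term j i :
  gram (fun x x' => w i * (grover_amp j i x * grover_amp j i x')).
Proof. exact: gramM (gram_cst (w_ge0 i)) (gram_rank1 _). Qed.

(* Reflecting about the vector with amplitudes [sqrt (w i)] preserves inner
   products, hence costs nothing at the level of kernels. *)
Lemma grover_reflection j x x' :
  \sum_i w i * (grover_amp j i x * grover_amp j i x') * phase (R := R) (y i) x x'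
  = grover_kernel j.+1 x x'.
Proof.
rewrite /grover_kernel.
pose f i x := if y i x then - (grover j x).1 else (grover j x).2.
pose c x := \sum_i w i * f i x.
have ampE i z : grover_amp j.+1 i z = 2 * c z - f i z.
  by rewrite /grover_amp /= /c /f; case: (y i z); rewrite ?opprK.
transitivity (\sum_i w i * (f i x * f i x')).
  apply: eq_bigr => i _; rewrite /phase /grover_amp /f -mulrA; congr (_ * _).
  by case: (y i x); case: (y i x'); rewrite /= ?expr0 ?expr1; ring.
under [RHS]eq_bigr => i _ do rewrite !ampE.
transitivity (\sum_i (4 * c x * c x' * w i - 2 * c x * (w i * f i x')
    - 2 * c x' * (w i * f i x) + w i * (f i x * f i x'))); last first.
  by apply: eq_bigr => i _; ring.
rewrite big_split /= !sumrB -!mulr_sumr w_sum1 -/(c x) -/(c x').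
by move: (c x) (c x') => u v; ring.
Qed.

Lemma grover_queries j : queries inp (j * T) one_kernel (grover_kernel j).
Proof.
elim: j => [|j IH].
  move=> x x'; rewrite /grover_kernel /one_kernel -w_sum1; apply: eq_bigr => i _.
  by rewrite /grover_amp /=; case: (y i x); case: (y i x'); rewrite !mulr1.
rewrite mulSnr; apply: queries_trans IH _.
apply: queries_ext (queries_sum _ (fun i => flipsM (gram_grover_term j i) (y_flips i))).
  by [].
exact: grover_reflection.
Qed.

(** Each iteration rotates by [2 * th] in the plane of the marked and unmarked parts. The
    denominators arise because amplitudes are taken relative to [sqrt (w i)]. *)
Lemma grover_angle x (th : R) j : sin th != 0 -> cos th != 0 ->
  \sum_i w i * (y i x)%:R = sin th ^+ 2 ->
  grover j x = (sin (j.*2.+1%:R * th) / sin th, cos (j.*2.+1%:R * th) / cos th).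
Proof.
move=> s0 c0 hm; elim: j => [|j IH] /=; first by rewrite mul1r !divff.
rewrite IH /=; set u := j.*2.+1%:R * th.
have hu : j.*2.+3%:R * th = u + th + th.
  by rewrite /u -addn2 natrD; ring.
(* Overlap of the phase-flipped state with the axis of the reflection. *)
have hc : \sum_i w i * (if y i x then - (sin u / sin th) else cos u / cos th)
   = cos (u + th).
  transitivity (\sum_i (w i * (cos u / cos th)
      - w i * (y i x)%:R * (sin u / sin th + cos u / cos th))).
    by apply: eq_bigr => i _; case: (y i x) => /=; ring.
  rewrite sumrB -!mulr_suml w_sum1 hm cosD.
  have -> : sin th ^+ 2 * (sin u / sin th + cos u / cos th)
     = sin u * sin th + (1 - cos th ^+ 2) * (cos u / cos th).
    by rewrite -sin2cos2; field; rewrite s0 c0.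
  by field.
rewrite hc doubleS hu; congr pair.
  rewrite [sin (u + th + th)]sinD.
  have -> : sin u = sin (u + th) * cos th - cos (u + th) * sin th.
    by rewrite -sinB addrK.
  by field.
rewrite [cos (u + th + th)]cosD.
have -> : cos u = cos (u + th) * cos th + sin (u + th) * sin th.
  by rewrite -cosB addrK.
by field.
Qed.

(** The angle for which [J] iterations end exactly at pi / 2. *)
Definition grover_th J : R := pi / 2 / J.*2.+1%:R.

Lemma grover_th_itv J : (0 < J)%N -> 0 < grover_th J < pi / 2.
Proof.
move=> J0; rewrite /grover_th divr_gt0 ?divr_gt0 ?pi_gt0 //=.
rewrite ltr_pdivrMr // ltr_pMr ?divr_gt0 ?pi_gt0 //.
by rewrite ltr1n ltnS double_gt0.
Qed.

(* After [J] iterations the unmarked amplitude is proportional to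
   cos (pi / 2); a last query of [y i] then flags the marked items. *)
Lemma grover_onesided J (Y G : X -> bool) : (0 < J)%N ->
  (forall i x, y i x -> Y x) ->
  (forall x, G x -> \sum_i w i * (y i x)%:R = sin (grover_th J) ^+ 2) ->
  onesided (R := R) inp (J.+1 * T) Y G.
Proof.
move=> J0 hY hG; have /andP[t0 t1] := grover_th_itv J0.
have s0 : sin (grover_th J) != 0 by rewrite gt_eqF ?sin_gt0_pihalf ?t0.
have c0 : cos (grover_th J) != 0.
  by rewrite gt_eqF // cos_gt0_pihalf // t1 andbT (lt_trans _ t0) // oppr_lt0 divr_gt0 ?pi_gt0.
pose part b x x' := \sum_i w i * (grover_amp J i x * grover_amp J i x')
   * ((y i x == b)%:R * (y i x' == b)%:R).
have gpart b : gram (part b).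
  apply: gram_sum => i; apply: gramM; first exact: gram_grover_term.
  exact: gram_rank1.
exists (part true), (part false); split=> //.
- rewrite mulSnr; apply: queries_trans (grover_queries J) _.
  have h := fun i => flips_agree (gram_grover_term J i) (y_flips i).
  apply: queries_ext (queries_sum _ h) => // x x'.
  rewrite -big_split; apply: eq_bigr => i _ /=; rewrite -mulrDr; congr (_ * _).
  by rewrite /agree; case: (y i x); case: (y i x'); rewrite /= ?mulr0 ?mulr1 ?addr0 ?add0r.
- move=> x x' h; apply: big1 => i _; case: (boolP (y i x)) => [/hY yx|];
    last by rewrite mul0r mulr0.
  by case: (boolP (y i x')) => [/hY yx'|]; [rewrite yx yx' in h|rewrite !mulr0].
- have B0 x : G x -> (grover J x).2 = 0.
    move=> /hG e; rewrite (grover_angle J s0 c0 e) /= mulrCA divff // mulr1.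
    by rewrite cos_pihalf mul0r.
  move=> x x' /orP[] /B0 e; apply: big1 => i _; rewrite /grover_amp e.
    by case: (y i x); rewrite /= ?(mul0r,mulr0).
  by case: (y i x'); rewrite /= ?(mul0r,mulr0).
Qed.

End Grover.

Lemma sin_le_id (R : realType) (x : R) : 0 <= x -> sin x <= x.
Proof.
move=> x0; have hd z : z \in `]0, x[ -> is_derive z 1 (@sin R) (cos z).
  by move=> _; apply: is_derive_sin.
have cs : {within `[0, x], continuous (@sin R)}%classic.
  by apply: continuous_subspaceT => z; exact: continuous_sin.
have [c _] := MVT_segment x0 hd cs.
rewrite sin0 !subr0 => ->.
by rewrite ler_piMl // cos_le1.
Qed.

(** * Exact search for a known number of marked items *)

Section Search.
Context {R : realType} {N : nat} {X : Type} (inp : X -> input N).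

(** [J] is the least number with [s <= J ^ 2 * t], so [J.-1] is at most the square root; the bound
    is on [J.+1] because of the final flagging query. *)
Lemma search_rounds (s t : nat) : (0 < t <= s)%N ->
  exists2 J, (0 < J)%N & (s <= J ^ 2 * t)%N /\
    J.+1%:R <= 3 * Num.sqrt (s%:R / t%:R) :> R.
Proof.
move=> /andP[t0 ts].
have ex : exists J, (s <= J ^ 2 * t)%N.
  exists s; case: s ts => // s _.
  by rewrite -mulnA leq_pmulr // muln_gt0.
case: (ex_minnP ex) => J hJ minJ; exists J.
  by case: J hJ {minJ} => //; rewrite exp0n // mul0n leqn0 => /eqP s0; rewrite s0 leqNgt t0 in ts.
split=> //.
have q1 : 1 <= Num.sqrt (s%:R / t%:R) :> R.
  by rewrite -[leLHS]sqrtr1 ler_sqrt ?divr_ge0 // ler_pdivlMr ?ltr0n // mul1r ler_nat.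
suff : J.-1%:R <= Num.sqrt (s%:R / t%:R) :> R.
  move=> h; have : J.+1%:R <= J.-1%:R + 2 :> R.
    by rewrite -natrD ler_nat; case: (J) => // ?; rewrite addn2.
  by move: q1 h; lra.
rewrite -[leLHS]ger0_norm // -sqrtr_sqr ler_sqrt ?divr_ge0 //.
rewrite ler_pdivlMr ?ltr0n // -natrX -natrM ler_nat.
case: J {hJ} minJ => // J minJ; rewrite leqNgt; apply/negP => /ltnW /minJ.
by rewrite ltnn.
Qed.

Lemma sin_grover_th J : (0 < J)%N -> sin (grover_th (R := R) J) <= J%:R^-1.
Proof.
move=> J0; have /andP[t0 _] := grover_th_itv (R := R) J0.
apply: le_trans (sin_le_id (ltW t0)) _.
rewrite /grover_th ler_pdivrMr // [leRHS]mulrC ler_pdivlMr ?ltr0n //.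
apply: le_trans (_ : 2 * J%:R <= _); first by rewrite ler_wpM2r // ltW // pihalf_lt2.
by rewrite -natrM ler_nat -mul2n leqnSn.
Qed.

(* Besides the items, an extra item that is never marked carries the weight
   that makes the rotation angle exactly [grover_th J]. *)
Lemma search_onesided (I : finType) t : (0 < t <= #|I|)%N ->
  exists2 J, (forall (y : I -> X -> bool) T (Y : X -> bool),
      (forall i, flips (R := R) inp T (y i)) -> (forall i x, y i x -> Y x) ->
      onesided (R := R) inp (J * T) Y (fun x => #|[pred i | y i x]| == t))
    & J%:R <= 3 * Num.sqrt (#|I|%:R / t%:R) :> R.
Proof.
move=> ht; have [J J0 [hJ cJ]] := search_rounds ht.
exists J.+1 => // y T Y hy hY; have /andP[t0 tI] := ht.
(* With weight [b] each, [t] marked items weigh exactly [sn ^+ 2]. *)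
set sn : R := sin (grover_th J); pose b := sn ^+ 2 / t%:R.
have tR : 0 < t%:R :> R by rewrite ltr0n.
have sn0 : 0 <= sn.
  by have /andP[? ?] := grover_th_itv (R := R) J0; rewrite ltW // sin_gt0_pihalf //; apply/andP.
have b0 : 0 <= b by rewrite divr_ge0 ?sqr_ge0 ?ltW.
(* The extra item thus gets a nonnegative weight; this is where [s <= J ^ 2 * t] enters. *)
have b1 : #|I|%:R * b <= 1.
  rewrite mulrA ler_pdivrMr // mul1r.
  apply: le_trans (_ : #|I|%:R * (J%:R^-1) ^+ 2 <= _).
    by rewrite ler_wpM2l // lerXn2r ?nnegrE ?invr_ge0 // sin_grover_th.
  rewrite exprVn ler_pdivrMr ?exprn_gt0 ?ltr0n // -natrX -natrM ler_nat.
  by rewrite mulnC.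
pose w (o : option I) := if o is Some _ then b else 1 - #|I|%:R * b.
pose z (o : option I) x := if o is Some i then y i x else false.
have sumE (F : option I -> R) : \sum_o F o = F None + \sum_i F (Some i).
  rewrite (bigD1 None) //= (reindex_omap Some id) /=; last by case.
  by congr (_ + _); apply: eq_bigl => i; rewrite eqxx.
apply: (@grover_onesided _ _ _ _ _ w z) => //.
- by case=> [i|] //=; rewrite subr_ge0.
- by rewrite sumE /= sumr_const -[b *+ _]mulr_natl; exact: subrK.
- by case=> [i|]; [apply: hy|exact: (flips_const inp T)].
- by case=> [i|] //= x; apply: hY.
- move=> x /eqP hx; rewrite sumE /= mulr0 add0r -mulr_sumr.
  under eq_bigr do rewrite mulrb. rewrite -big_mkcond /= sumr_const hx.
  by rewrite /b -mulrA mulVf ?mulr1 // gt_eqF.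
Qed.
End Search.

(** * Covering families of searches *)

Section Covering.
Context {R : realType}.

(* Averaging over the seeds, then greedy choice: every chosen seed captures a
   fraction [c] of the weight that is still uncovered. *)
Lemma greedy_seeds (F P : finType) (good : F -> P -> bool) (D : pred P)
    (nu : P -> R) (c : R) (m : nat) :
  (0 < #|F|)%N -> (forall p, 0 <= nu p) -> c <= 1 ->
  (forall p, D p -> c * #|F|%:R <= #|[pred f | good f p]|%:R) ->
  exists2 l : seq F, size l = m &
    \sum_(p | D p && ~~ has (good^~ p) l) nu p <= (1 - c) ^+ m * \sum_(p | D p) nu p.
Proof.
move=> F0 nu0 c1 hc; elim: m => [|m [l sl IH]].
  exists [::] => //; rewrite expr0 mul1r le_eqVlt; apply/orP; left; apply/eqP.
  by apply: eq_bigl => p; rewrite andbT.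
pose U p := D p && ~~ has (good^~ p) l.
(* If every seed captured less than the fraction [c], summing over the seeds and exchanging the sums
   would contradict [hc]. *)
have [f hf] : exists f, c * \sum_(p | U p) nu p <= \sum_(p | U p && good f p) nu p.
  apply/existsP; apply: contraT; rewrite negb_exists => /forallP hlt.
  have : \sum_f \sum_(p | U p && good f p) nu p < \sum_(f : F) c * \sum_(p | U p) nu p.
    case/card_gt0P: F0 => f0 _.
    rewrite [ltRHS](bigD1 f0) // [ltLHS](bigD1 f0) //=.
    apply: ltr_leD; first by rewrite ltNge.
    by apply: ler_sum => f _; rewrite leNgt; apply: contra (hlt f) => /ltW.
  rewrite ltNge; case/negP.
  rewrite sumr_const -mulr_natl mulrA [_ * c]mulrC mulr_sumr.
  under [leRHS]eq_bigr => f _ do rewrite big_mkcondr.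
  rewrite [leRHS]exchange_big /=; apply: ler_sum => p /andP[Dp _].
  rewrite -big_mkcond /= sumr_const -[nu p *+ _]mulr_natl ler_wpM2r //.
  exact: hc.
exists (f :: l); first by rewrite /= sl.
rewrite exprS -mulrA.
apply: le_trans (_ : (1 - c) * \sum_(p | U p) nu p <= _); last first.
  by rewrite ler_wpM2l // subr_ge0.
have -> : \sum_(p | D p && ~~ has (good^~ p) (f :: l)) nu p
    = \sum_(p | U p && ~~ good f p) nu p.
  by apply: eq_bigl => p; rewrite /= negb_or /U andbA andbAC.
move: hf; rewrite [\sum_(p | U p) _](bigID (good f)) /=; lra.
Qed.

Lemma ler_sum_pred (P : finType) (A B : pred P) (nu : P -> R) :
  (forall p, 0 <= nu p) -> (forall p, A p -> B p) ->
  \sum_(p | A p) nu p <= \sum_(p | B p) nu p.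
Proof.
move=> nu0 AB; rewrite [leLHS]big_mkcond [leRHS]big_mkcond; apply: ler_sum => p _.
by case: (boolP (A p)) => [/AB -> //|_]; case: ifP.
Qed.

Lemma bernoulli (q : R) k : 0 <= q <= 1 -> 1 - k%:R * q <= (1 - q) ^+ k.
Proof.
move=> /andP[q0 q1]; elim: k => [|k IH]; first by rewrite mul0r subr0.
rewrite exprS; apply: le_trans (_ : (1 - q) * (1 - k%:R * q) <= _); last first.
  by rewrite ler_wpM2l // subr_ge0.
rewrite -natr1; have : 0 <= k%:R * q * q by rewrite !mulr_ge0.
lra.
Qed.

(** The inverse is [(24 / 23) ^+ 24 >= 1 + 24 / 23 >= 2]. *)
Lemma half_power : (1 - 24^-1 : R) ^+ 24 <= 2^-1.
Proof.
have h : 1 + 24 * 23^-1 <= (24 / 23 : R) ^+ 24.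
  have : forall k, 1 + k%:R * 23^-1 <= (24 / 23 : R) ^+ k; last by apply.
  elim=> [|k IH]; first by rewrite mul0r addr0.
  rewrite exprS; apply: le_trans (_ : 24 / 23 * (1 + k%:R * 23^-1) <= _); last first.
    by rewrite ler_wpM2l // divr_ge0.
  rewrite -natr1; have : 0 <= k%:R :> R by [].
  lra.
have -> : (1 - 24^-1 : R) = (24 / 23)^-1 by field.
rewrite exprVn lef_pV2 ?posrE ?exprn_gt0 ?divr_gt0 //.
by apply: le_trans h; lra.
Qed.

(** Choose the position of the hit, its value in [p], and the other values outside [p]. Formally,
    the indicator of a single hit is a sum over positions of products of [ind], so the sum over [f]
    factors coordinatewise. *)
Lemma card_single_hit n s (p : {set 'I_n}) :
  #|[pred f : {ffun 'I_s -> 'I_n} | #|[pred r | f r \in p]| == 1%N]| =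
  (s * (#|p| * (n - #|p|) ^ s.-1))%N.
Proof.
rewrite -[LHS]sum1_card big_mkcond /=.
pose ind (r r' : 'I_s) (j : 'I_n) : nat := (j \in p) == (r' == r).
transitivity (\sum_(f : {ffun 'I_s -> 'I_n}) \sum_r \prod_r' ind r r' (f r'))%N.
  apply: eq_bigr => f _.
  pose h := [set r | f r \in p].
  have hE r : (\prod_r' ind r r' (f r') = (h == [set r]))%N.
    have [e|ne] := eqVneq h [set r].
      apply: big1 => r' _; rewrite /ind.
      by move/setP/(_ r'): e; rewrite !inE => ->; rewrite eqxx.
    apply/eqP; rewrite -leqn0 leqNgt; apply: contra ne => hp.
    apply/eqP/setP => r'; rewrite !inE.
    have := gt0_prodn hp r' isT; rewrite /ind.
    by case: eqP.
  under [RHS]eq_bigr => r _ do rewrite hE.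
  rewrite inE /=; have -> : #|[pred r | f r \in p]| = #|h| by rewrite cardsE.
  case: cards1P => [[r0 ->]|nh].
    rewrite (bigD1 r0) //= eqxx big1 ?addn0 // => r ne.
    by case: eqP => // /set1_inj e; rewrite e eqxx in ne.
  rewrite big1 // => r _; case: eqP => // e.
  by case: nh; exists r.
rewrite exchange_big /=.
under eq_bigr => r _ do rewrite -bigA_distr_bigA /=.
transitivity (\sum_(r < s) #|p| * (n - #|p|) ^ s.-1)%N; last first.
  by rewrite sum_nat_const card_ord.
apply: eq_bigr => r _; rewrite (bigD1 r) //=; congr (_ * _)%N.
  rewrite -sum1_card [RHS]big_mkcond /=; apply: eq_bigr => j _.
  by rewrite /ind eqxx; case: (j \in p).
transitivity (\prod_(r' < s | r' != r) (n - #|p|))%N.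
  apply: eq_bigr => r' ne; have -> : (n - #|p| = #|~: p|)%N.
    by rewrite [RHS]cardsCs finset.setCK card_ord.
  rewrite -sum1_card [RHS]big_mkcond /=.
  by apply: eq_bigr => j _; rewrite /ind (negPf ne) inE; case: (j \in p).
by rewrite prod_nat_const cardC1 card_ord.
Qed.

(** One search: [item] lists the pool, possibly with repetitions, and [target] is the guessed number
    of hits. *)
Record stage n := Stage { pool : nat; item : 'I_pool -> 'I_n; target : nat }.

Definition hits n (st : stage n) (p : {set 'I_n}) : bool :=
  #|[pred r | @item n st r \in p]| == target st.

Definition valid n (st : stage n) : bool := (0 < target st <= pool st)%N.

Definition cost n (st : stage n) : R := Num.sqrt ((pool st)%:R / (target st)%:R).

Definition single n s (f : {ffun 'I_s -> 'I_n}) : stage n := Stage f 1.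

(** Sets of size between [tau] and [4 * tau] are hit a constant number of times on average; [maxn]
    keeps the pool nonempty when [n < 8 * tau]. *)
Definition pool_size n tau : nat := maxn 1 (n %/ (8 * tau)).

Lemma cost_single n tau (f : {ffun 'I_(pool_size n tau) -> 'I_n}) :
  (0 < tau <= n)%N -> cost (single f) <= Num.sqrt (n%:R / tau%:R).
Proof.
move=> /andP[t0 tn]; rewrite /cost /= divr1 ler_sqrt ?divr_ge0 //.
rewrite ler_pdivlMr ?ltr0n // -natrM ler_nat /pool_size.
have := leq_divM n (8 * tau); nia.
Qed.

(* With [q = #|p| / n] and [s] the pool size, a random pool has exactly one
   hit with probability [s q (1 - q)^(s-1) >= s q / 2], by Bernoulli. *)
Lemma single_hit_often n tau (p : {set 'I_n}) : let s := pool_size n tau in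
  (0 < tau)%N -> (tau <= #|p| < 4 * tau)%N ->
  24^-1 * #|{: {ffun 'I_s -> 'I_n}}|%:R
    <= #|[pred f : {ffun 'I_s -> 'I_n} | hits (single f) p]|%:R :> R.
Proof.
move=> s tau0 /andP[tp pt].
have pn : (#|p| <= n)%N by rewrite -[leqRHS]card_ord max_card.
have n0 : (0 < n)%N by lia.
have nR : 0 < n%:R :> R by rewrite ltr0n.
rewrite card_single_hit card_ffun !card_ord.
have s0 : (0 < s)%N by rewrite leq_max.
have [k ek] : exists k, s = k.+1 by exists s.-1; rewrite prednK.
rewrite ek.
rewrite !natrM !natrX natrB //= exprS.
set t : R := #|p|%:R; set x := n%:R in nR *.
(* A pool of size one means [n < 16 * tau], so a single random item already hits with probability
   above 1/16. *)
have [k0|k0] := posnP k.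
  rewrite k0 !expr0 !mulr1 mul1r mulrC ler_pdivrMr // /x /t -natrM ler_nat.
  move: ek; rewrite k0 /s /pool_size => ek.
  have : (n %/ (8 * tau) < 2)%N by lia.
  by rewrite ltn_divLR ?muln_gt0 //; lia.
have [h1 h2] : (k.+1 * (8 * tau) <= n)%N /\ (n < k.+2 * (8 * tau))%N.
  have -> : k.+1 = (n %/ (8 * tau))%N by move: ek; rewrite /s /pool_size; lia.
  by rewrite leq_divM ltn_ceil // muln_gt0.
have hq : 1 - k%:R * (t / x) <= (1 - t / x) ^+ k.
  by apply: bernoulli; rewrite divr_ge0 //= ler_pdivrMr // mul1r ler_nat.
have -> : x - t = x * (1 - t / x) by field; rewrite gt_eqF.
rewrite exprMn.
have hkt : k%:R * (t / x) <= 2^-1.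
  have : k%:R * t * 2 <= x by rewrite /x /t -!natrM ler_nat; nia.
  by rewrite mulrA ler_pdivrMr //; lra.
(* As [k >= 1], [k.+2] is at most 3/2 of [k.+1], whence 12 = 8 * 3/2. With the factor 1/2 that [hq]
   and [hkt] provide, this yields 1/24. *)
have hst : x <= 12 * (k.+1%:R * t) by rewrite /x /t -!natrM ler_nat; nia.
have kt0 : 0 <= k.+1%:R * t by rewrite mulr_ge0.
apply: le_trans (_ : k.+1%:R * t * (x ^+ k * 2^-1) <= _).
  rewrite [leLHS]mulrA [x ^+ k * _]mulrC [leRHS]mulrA.
  by apply: ler_wpM2r; [rewrite exprn_ge0 // ltW|lra].
rewrite -mulrA ler_wpM2l // ler_wpM2l //; apply: ler_wpM2l.
  by rewrite exprn_ge0 // ltW.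
by apply: le_trans hq; lra.
Qed.

Definition uncovered n (l : seq (stage n)) p := ~~ has (fun st => hits st p) l.

(** Each greedily chosen pool captures 1/24 of the remaining weight, so every 24 of them halve
    it. *)
Lemma cover_level n tau L (nu : {set 'I_n} -> R) : (0 < tau <= n)%N ->
  (forall p, 0 <= nu p) ->
  exists l : seq (stage n), [/\ all (@valid n) l,
    \sum_(st <- l) cost st <= (24 * L)%:R * Num.sqrt (n%:R / tau%:R) &
    \sum_(p : {set 'I_n} | (tau <= #|p| < 4 * tau)%N && uncovered l p) nu p
      <= 2^-1 ^+ L * \sum_(p : {set 'I_n} | (tau <= #|p| < 4 * tau)%N) nu p].
Proof.
move=> /andP[t0 tn] nu0.
have F0 : (0 < #|{: {ffun 'I_(pool_size n tau) -> 'I_n}}|)%N.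
  by rewrite card_ffun !card_ord expn_gt0 (leq_trans t0 tn).
have c1 : 24^-1 <= 1 :> R by lra.
have [l sl hl] := greedy_seeds
  (good := fun f p => hits (@single n _ f) p)
  (D := fun p : {set 'I_n} => (tau <= #|p| < 4 * tau)%N)
  (24 * L) F0 nu0 c1 (fun p => single_hit_often t0).
exists (map (fun f => single f) l); split.
- by rewrite all_map; apply/allP => f _ /=; rewrite /valid /= leq_max.
- rewrite big_map -sl; elim: (l) => [|f l' IH]; first by rewrite big_nil mul0r.
  rewrite big_cons /= -natr1 mulrDl mul1r addrC lerD //.
  by rewrite cost_single ?t0.
apply: le_trans (_ : (1 - 24^-1) ^+ (24 * L) *
    \sum_(p : {set 'I_n} | (tau <= #|p| < 4 * tau)%N) nu p <= _).
  apply: le_trans hl; rewrite le_eqVlt; apply/orP; left; apply/eqP.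
  by apply: eq_bigl => p; rewrite /uncovered has_map.
rewrite ler_wpM2r ?sumr_ge0 // exprM lerXn2r ?nnegrE ?half_power ?exprn_ge0 //; lra.
Qed.

(** [cover_level] is applied at the scales [tau], [4 * tau], [16 * tau], and so on. The cost halves
    from one scale to the next, so the total is at most twice the first cost. *)
Lemma cover_large n L tau (nu : {set 'I_n} -> R) : (0 < tau)%N ->
  (forall p, 0 <= nu p) ->
  exists l : seq (stage n), [/\ all (@valid n) l,
    \sum_(st <- l) cost st <= (48 * L)%:R * Num.sqrt (n%:R / tau%:R) &
    \sum_(p : {set 'I_n} | (tau <= #|p|)%N && uncovered l p) nu p
      <= 2^-1 ^+ L * \sum_(p : {set 'I_n} | (tau <= #|p|)%N) nu p].
Proof.
(* [d] bounds the number of scales left before sizes exceed [n]. *)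
move=> t0 nu0; have [d hd] : exists d, (n < 4 ^ d * tau)%N.
  by exists n; apply: leq_trans (leq_pmulr _ t0); apply: ltn_expl.
elim: d tau t0 hd => [|d IH] tau t0 hd.
  exists [::]; split=> //; first by rewrite big_nil mulr_ge0 ?sqrtr_ge0.
  have nop (p : {set 'I_n}) : (tau <= #|p|)%N = false.
    apply/negbTE; rewrite -ltnNge; apply: leq_ltn_trans (_ : (n < tau)%N).
      by rewrite -[leqRHS]card_ord max_card.
    by rewrite mul1n in hd.
  by rewrite !big_pred0 ?mulr0 // => p; rewrite nop.
have [tn|nt] := leqP tau n; last first.
  exists [::]; split=> //; first by rewrite big_nil mulr_ge0 ?sqrtr_ge0.
  have nop (p : {set 'I_n}) : (tau <= #|p|)%N = false.
    apply/negbTE; rewrite -ltnNge; apply: leq_ltn_trans nt.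
    by rewrite -[leqRHS]card_ord max_card.
  by rewrite !big_pred0 ?mulr0 // => p; rewrite nop.
have [l1 [v1 c1 h1]] := cover_level (tau := tau) L (introT andP (conj t0 tn)) nu0.
have t4 : (0 < 4 * tau)%N by rewrite muln_gt0.
have hd4 : (n < 4 ^ d * (4 * tau))%N by rewrite mulnA -expnSr.
have [l2 [v2 c2 h2]] := IH _ t4 hd4.
exists (l1 ++ l2); split.
- by rewrite all_cat v1.
- rewrite big_cat /=; apply: le_trans (lerD c1 c2) _.
  have -> : n%:R / (4 * tau)%:R = (2^-1) ^+ 2 * (n%:R / tau%:R) :> R.
    by rewrite natrM; field; rewrite pnatr_eq0 -lt0n t0.
  rewrite (sqrtrM _ (sqr_ge0 2^-1)) sqrtr_sqr ger0_norm // !natrM; lra.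
have part (Q : pred {set 'I_n}) (f : {set 'I_n} -> R) :
    \sum_(p : {set 'I_n} | (tau <= #|p|)%N && Q p) f p
  = \sum_(p : {set 'I_n} | (tau <= #|p| < 4 * tau)%N && Q p) f p
  + \sum_(p : {set 'I_n} | (4 * tau <= #|p|)%N && Q p) f p.
  rewrite (bigID (fun p : {set 'I_n} => (#|p| < 4 * tau)%N)) /=.
  congr (_ + _); apply: eq_bigl => p; first by rewrite andbAC.
  by rewrite -leqNgt andbAC andbC; case: (Q p) => //=; lia.
have -> : \sum_(p : {set 'I_n} | (tau <= #|p|)%N) nu p
  = \sum_(p : {set 'I_n} | (tau <= #|p| < 4 * tau)%N) nu p
  + \sum_(p : {set 'I_n} | (4 * tau <= #|p|)%N) nu p.
  have := part xpredT nu; under eq_bigl => p do rewrite andbT.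
  by move=> ->; congr (_ + _); apply: eq_bigl => p; rewrite andbT.
rewrite part mulrDr; apply: lerD.
  apply: le_trans _ h1; apply: ler_sum_pred => // p /andP[->].
  by rewrite /uncovered has_cat negb_or => /andP[].
apply: le_trans _ h2; apply: ler_sum_pred => // p /andP[->].
by rewrite /uncovered has_cat negb_or => /andP[].
Qed.

(** Telescoping, by 1 / b <= 2 (b - a) for consecutive square roots a and b, which amounts to (b -
    a)^2 >= 0. *)
Lemma sum_inv_sqrt n m :
  \sum_(1 <= t < m.+1) Num.sqrt (n%:R / t%:R) <= 2 * Num.sqrt (n * m)%:R :> R.
Proof.
elim: m => [|m IH]; first by rewrite big_nil mulr_ge0 // sqrtr_ge0.
rewrite big_nat_recr //=; apply: le_trans (lerD IH (lexx _)) _.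
set b : R := Num.sqrt m.+1%:R; set a : R := Num.sqrt m%:R.
have b0 : 0 < b by rewrite sqrtr_gt0 ltr0n.
have hb : b ^+ 2 = a ^+ 2 + 1 by rewrite !sqr_sqrtr // natr1.
rewrite !natrM !sqrtrM // sqrtrV // -/a -/b mulrCA [leRHS]mulrCA -mulrDr.
rewrite ler_wpM2l ?sqrtr_ge0 // -(ler_pM2r b0) mulrDl mulVf ?gt_eqF //.
by have := sqr_ge0 (b - a); move: hb; rewrite !expr2; lra.
Qed.

(* Patterns of at most [L] items are found by guessing their exact size, larger
   ones by random pools. *)
Lemma covering n L (nu : {set 'I_n} -> R) : (0 < L)%N ->
  (forall p, 0 <= nu p) ->
  exists l : seq (stage n), [/\ all (@valid n) l,
    \sum_(st <- l) cost st <= 50 * Num.sqrt (n * L)%:R &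
    \sum_(p : {set 'I_n} | (0 < #|p|)%N && uncovered l p) nu p <= 2^-1 ^+ L * \sum_p nu p].
Proof.
move=> L0 nu0; have [l [vl cl hl]] := cover_large L L0 nu0.
(* The pool consists of all items. Targets stop at [minn L n], since a target above the pool size is
   not valid. *)
pose small := [seq @Stage n n id t | t <- index_iota 1 (minn L n).+1].
exists (small ++ l); split.
- rewrite all_cat vl andbT all_map; apply/allP => t /=.
  by rewrite mem_index_iota /valid /= ltnS leq_min => /and3P[-> _ ->].
(* The constant 50 is 2 from the exact sizes plus 48 from the pools. *)
- rewrite big_cat big_map /=.
  apply: le_trans (lerD (sum_inv_sqrt _ _) cl) _.
  have -> : (48 * L)%:R * Num.sqrt (n%:R / L%:R) = 48 * Num.sqrt (n * L)%:R :> R.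
    rewrite !natrM -mulrA; congr (_ * _).
    have LR : 0 < L%:R :> R by rewrite ltr0n.
    rewrite -{1}[L%:R]ger0_norm // -sqrtr_sqr -sqrtrM ?sqr_ge0 //; congr Num.sqrt.
    by field; rewrite gt_eqF.
  have : Num.sqrt (n * minn L n)%:R <= Num.sqrt (n * L)%:R :> R.
    by rewrite ler_sqrt // ler_nat leq_mul2l geq_minl orbT.
  lra.
apply: le_trans (_ : \sum_(p : {set 'I_n} | (L <= #|p|)%N && uncovered l p) nu p <= _).
  apply: ler_sum_pred => // p /andP[p0].
  rewrite /uncovered has_cat negb_or => /andP[hs ->]; rewrite andbT leqNgt.
  apply: contra hs => pL; rewrite has_map; apply/hasP; exists #|p|.
    rewrite mem_index_iota ltnS leq_min (ltnW pL).
    by rewrite p0 -[leqRHS]card_ord max_card.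
  by rewrite /hits /= eqxx.
apply: le_trans hl _; rewrite ler_wpM2l ?exprn_ge0 ?invr_ge0 //.
by apply: ler_sum_pred.
Qed.

End Covering.

(** * From kernels to algorithms *)

Section IsometryExtension.
Context {C : numClosedFieldType}.
Local Open Scope sesquilinear_scope.

Lemma mulmx_tC_eq0 n d (M : 'M[C]_(n, d)) : M *m M ^t* = 0 -> M = 0.
Proof.
move=> h; apply/matrixP => i j; rewrite mxE.
have /eqP := congr1 (fun A : 'M[C]_n => A i i) h; rewrite !mxE psumr_eq0 => [|k _].
  by move/allP/(_ j (mem_index_enum j)); rewrite !mxE mul_conjC_eq0 => /eqP.
by rewrite !mxE mul_conjC_ge0.
Qed.

Lemma trmxC_mul m n p (A : 'M[C]_(m, n)) (B : 'M[C]_(n, p)) :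
  (A *m B) ^t* = B ^t* *m A ^t*.
Proof. by rewrite trmx_mul map_mxM. Qed.

(** The added rows are an orthonormal basis of the orthogonal complement, obtained as the kernel of
    the adjoint of [S]. *)
Lemma unitary_completion r q (S : 'M[C]_(r, r + q)) : S \is unitarymx ->
  exists X : 'M[C]_(q, r + q), col_mx S X \is unitarymx.
Proof.
move=> hS; pose K := kermx (S ^t*).
have rK : \rank K = q by rewrite mxrank_ker mxrank_map mxrank_tr mxrank_unitary // addKn.
have hX : schmidt (row_base K) *m S ^t* = 0.
  by apply/sub_kermxP; rewrite eqmx_schmidt_free ?row_base_free // eq_row_base.
have uX := schmidt_unitarymx (row_base K) (rank_leq_col K).
move: (schmidt _) hX uX; rewrite rK => X hX /unitarymxP uX; exists X.
apply/unitarymxP; rewrite tr_col_mx map_row_mx mul_col_row hX uX (unitarymxP hS).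
have -> : S *m X ^t* = 0.
  by rewrite -[LHS]trmxCK trmxC_mul trmxCK hX trmx0 map_mx0.
by rewrite -scalar_mx_block.
Qed.

(** Both matrices are completed to square unitaries; [U] is the adjoint of the first times the
    second. *)
Lemma unitary_rows_transport r d (S S' : 'M[C]_(r, d)) :
  S \is unitarymx -> S' \is unitarymx ->
  exists2 U : 'M[C]_d, U \is unitarymx & S *m U = S'.
Proof.
move=> hS; have rd : (r <= d)%N by rewrite -(mxrank_unitary hS) rank_leq_col.
move: S S' hS; rewrite -(subnKC rd); move: (d - r)%N => q S S' hS hS'.
have [X uX] := unitary_completion hS; have [X' uX'] := unitary_completion hS'.
exists ((col_mx S X) ^t* *m col_mx S' X').
  by rewrite mul_unitarymx ?trmxC_unitary.
rewrite mulmxA; have := unitarymxP uX.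
rewrite -{1}[col_mx S X]/(col_mx S X) mul_col_mx scalar_mx_block.
case/eq_col_mx => -> _.
by rewrite mul_row_col mul1mx mul0mx addr0.
Qed.

(* Both families have the same coordinates with respect to an orthonormal basis
   of their span. *)
Lemma isometry_extension n d (V W : 'M[C]_(n, d)) :
  V *m V ^t* = W *m W ^t* -> exists2 U : 'M[C]_d, U \is unitarymx & V *m U = W.
Proof.
move=> e; pose S := schmidt (row_base V).
have uS : S \is unitarymx by rewrite schmidt_unitarymx // rank_leq_col.
have eS : (S :=: V)%MS.
  apply: eqmx_trans _ (eq_row_base V); apply: eqmx_schmidt_free.
  exact: row_base_free.
(* [K] writes [V] in the orthonormal basis [S], and [H] writes [S] in terms of [V]; by equality of
   Gram matrices, [H *m W] is orthonormal too. *)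
pose K := V *m pinvmx S; pose H := S *m pinvmx V.
have KS : K *m S = V by rewrite mulmxKpV // eS.
have HV : H *m V = S by rewrite mulmxKpV // eS.
have uS' : H *m W \is unitarymx.
  apply/unitarymxP; rewrite trmxC_mul mulmxA -[H *m W *m _]mulmxA -e.
  by rewrite mulmxA HV -mulmxA -trmxC_mul HV (unitarymxP uS).
(* [(1 - K H) W] has the same Gram matrix as [(1 - K H) V = 0]. *)
have KW : K *m (H *m W) = W.
  apply/eqP; rewrite eq_sym -subr_eq0 mulmxA -{1}[W]mul1mx -mulmxBl; apply/eqP.
  apply: mulmx_tC_eq0; rewrite trmxC_mul mulmxA -[_ *m W *m _]mulmxA -e.
  by rewrite mulmxA mulmxBl mul1mx -[K *m H *m V]mulmxA HV KS subrr !mul0mx.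
have [U uU hU] := unitary_rows_transport uS uS'.
by exists U => //; rewrite -KS -mulmxA hU.
Qed.

End IsometryExtension.

(** * States and gates realising a chain of kernels *)

Section StateConstruction.
Context {R : realType} {N : nat} (i0 : 'I_N).
Local Open Scope complex_scope.
Local Open Scope sesquilinear_scope.

Definition real_vec w (f : basis N w -> R) : 'cV[R[i]]_(dim N w) :=
  \col_s (f (enum_val s))%:C.

Lemma sum_basis w (F : basis N w -> R) :
  \sum_(s < dim N w) F (enum_val s) = \sum_b F b.
Proof.
rewrite [RHS](reindex (fun s : 'I_(dim N w) => enum_val s)) //=.
by apply: onW_bij; apply: enum_val_bij.
Qed.

Lemma real_vec_transport (X : finType) w (f g : X -> basis N w -> R) :
  (forall x x', \sum_b f x b * f x' b = \sum_b g x b * g x' b) ->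
  exists2 U : 'M[R[i]]_(dim N w), U \is unitarymx &
    forall x, U *m real_vec (f x) = real_vec (g x).
Proof.
move=> e; pose mx (h : X -> basis N w -> R) :=
  \matrix_(x < #|X|) (real_vec (h (enum_val x)))^T.
have gramE h x x' : (mx h *m (mx h) ^t*) x x'
    = (\sum_b h (enum_val x) b * h (enum_val x') b)%:C.
  rewrite -sum_basis !mxE rmorph_sum; apply: eq_bigr => s _.
  by rewrite !mxE rmorphM; congr (_ * _); exact: conjc_real.
have emx : mx f *m (mx f) ^t* = mx g *m (mx g) ^t*.
  by apply/matrixP => x x'; rewrite !gramE e.
have [U uU hU] := isometry_extension emx.
exists U^T; first by rewrite trmx_unitary.
move=> x; apply: trmx_inj; rewrite trmx_mul trmxK.
move/row_matrixP/(_ (enum_rank x)): hU.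
by rewrite row_mul !rowK enum_rankK.
Qed.

Lemma query_mapK w (x : input N) : involutive (@query_map N w x).
Proof. by case=> [[i b] z]; rewrite /query_map /= addbK. Qed.

Lemma oracle_real_vec w x (f : basis N w -> R) :
  oracle_mx R w x *m real_vec f = real_vec (f \o query_map x).
Proof.
apply/colP => s; rewrite !mxE /=.
have -> : (f (query_map x (enum_val s)))%:C
    = \sum_(b : basis N w) (enum_val s == query_map x b)%:R * (f b)%:C.
  rewrite (bigD1 (query_map x (enum_val s))) //= query_mapK eqxx mul1r.
  rewrite big1 ?addr0 // => b /negPf ne.
  by rewrite eq_sym (can2_eq (query_mapK x) (query_mapK x)) ne mul0r.
rewrite [RHS](reindex (fun t : 'I_(dim N w) => enum_val t)) /=.
  by apply: eq_bigr => t _; rewrite !mxE.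
by apply: onW_bij; apply: enum_val_bij.
Qed.

Context {X : finType} (inp : X -> input N).
Implicit Types (k : X -> X -> R).

Definition gram_tuple w k := exists a : w.-tuple bool -> X -> R,
  forall x x', k x x' = \sum_z a z x * a z x'.

Lemma gram_gram_tuple k : gram k ->
  exists w0, forall w, (w0 <= w)%N -> gram_tuple w k.
Proof.
move=> [vs h]; exists (size vs) => w hw.
have sz : (size vs <= #|{: w.-tuple bool}|)%N.
  by rewrite card_tuple card_bool (leq_trans hw) // ltnW // ltn_expl.
exists (fun z => nth (fun _ => 0) vs (enum_rank z)) => x x'.
rewrite h (big_nth (fun _ => 0)) big_mkord (big_ord_widen _ (fun j =>
  nth (fun _ => 0) vs j x * nth (fun _ => 0) vs j x') sz).
rewrite big_mkcond (reindex (@enum_rank (w.-tuple bool))) /=; last first.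
  by apply: onW_bij; apply: enum_rank_bij.
apply: eq_bigr => z _; case: ltnP => // hz.
by rewrite nth_default // mul0r.
Qed.

Definition query_step_tuple w k k' :=
  exists k0 (ki : 'I_N -> X -> X -> R),
    [/\ gram_tuple w k0, forall i, gram_tuple w (ki i),
        forall x x', k x x' = k0 x x' + \sum_i ki i x x' &
        forall x x', k' x x' =
          k0 x x' + \sum_i ki i x x' * phase (fun x => inp x i) x x'].

Fixpoint queries_tuple w T k k' : Prop :=
  if T is T'.+1 then exists2 k1, query_step_tuple w k k1 & queries_tuple w T' k1 k'
  else k =2 k'.

Lemma queries_queries_tuple T k k' : queries inp T k k' ->
  exists w0, forall w, (w0 <= w)%N -> queries_tuple w T k k'.
Proof.
elim: T k => [|T IH] k /=; first by exists 0%N.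
move=> [k1 [k0 [ki [h0 hi e e']]] /IH[w1 hw1]].
have [w2 hw2] := gram_gram_tuple h0.
have /choice[wi hwi] i := gram_gram_tuple (hi i).
exists (maxn w1 (maxn w2 (\max_i wi i))) => w; rewrite !geq_max => /and3P[l1 l2 l3].
exists k1; last exact: hw1.
exists k0, ki; split=> // [|i]; first exact: hw2.
by apply: hwi; apply: leq_trans l3; apply: leq_bigmax.
Qed.

Lemma sum_basis_split w (F : basis N w -> R) :
  \sum_b F b = \sum_i \sum_z (F (i, true, z) + F (i, false, z)).
Proof.
transitivity (\sum_(p : 'I_N * bool) \sum_z F (p, z)).
  by rewrite [RHS]pair_bigA; apply: eq_bigr => -[].
transitivity (\sum_i \sum_b \sum_z F (i, b, z)).
  by rewrite [RHS]pair_bigA; apply: eq_bigr => -[].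
by apply: eq_bigr => i _; rewrite big_bool big_split.
Qed.

(* The parts [ki i] sit at index [i] with the query bit in the state |->, and
   [k0] at index [i0] with the query bit in the state |+>. *)
Lemma query_step_state w k k' : query_step_tuple w k k' ->
  exists f : X -> basis N w -> R,
    (forall x x', \sum_b f x b * f x' b = k x x') /\
    (forall x x', \sum_b f x (query_map (inp x) b) * f x' (query_map (inp x') b)
                  = k' x x').
Proof.
move=> [k0 [ki [[a ha] /choice[c hc] e e']]].
pose h : R := Num.sqrt 2^-1.
have h2 : h * h = 2^-1 by rewrite -expr2 sqr_sqrtr // invr_ge0.
pose f x (s : basis N w) : R :=
  h * ((-1) ^+ s.1.2 * c s.1.1 s.2 x + (s.1.1 == i0)%:R * a s.2 x).
exists f; split=> x x'.
- rewrite sum_basis_split e ha.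
  transitivity (\sum_i ((i == i0)%:R * (\sum_z a z x * a z x') + ki i x x')); last first.
    by rewrite big_split /= -mulr_suml (bigD1 i0) //= eqxx big1 ?addr0 ?mul1r // => i /negPf ->.
  apply: eq_bigr => i _; rewrite hc mulr_sumr -big_split /=; apply: eq_bigr => z _.
  rewrite /f /= expr1 expr0 ![h * _ * (h * _)]mulrACA h2.
  by case: eqP => _ /=; field.
- rewrite sum_basis_split e' ha.
  transitivity (\sum_i ((i == i0)%:R * (\sum_z a z x * a z x')
      + ki i x x' * phase (fun x => inp x i) x x')); last first.
    by rewrite big_split /= -mulr_suml (bigD1 i0) //= eqxx big1 ?addr0 ?mul1r // => i /negPf ->.
  apply: eq_bigr => i _; rewrite hc mulr_suml mulr_sumr -big_split /=; apply: eq_bigr => z _.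
  rewrite /f /query_map /phase /= ![h * _ * (h * _)]mulrACA h2.
  by case: (inp x i); case: (inp x' i); case: eqP => _ /=; rewrite ?expr1 ?expr0; field.
Qed.

Lemma queries_gates w T k k' (f0 g : X -> basis N w -> R) :
  queries_tuple w T k k' ->
  (forall x x', \sum_b f0 x b * f0 x' b = k x x') ->
  (forall x x', \sum_b g x b * g x' b = k' x x') ->
  exists (U0 : 'M[R[i]]_(dim N w)) (Us : T.-tuple 'M[R[i]]_(dim N w)),
    [/\ U0 \is unitarymx, forall j, tnth Us j \is unitarymx &
    forall x, foldl (fun v U => U *m (oracle_mx R w (inp x) *m v))
       (U0 *m real_vec (f0 x)) Us = real_vec (g x)].
Proof.
elim: T k f0 => [|T IH] k f0 /=.
  move=> e hf hg; have [|U uU hU] := @real_vec_transport X w f0 g.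
    by move=> x x'; rewrite hf hg e.
  by exists U, [tuple]; split=> // -[].
move=> [k1 /query_step_state[f [hk hk1]] hq] hf hg.
have [|U uU hU] := @real_vec_transport X w f0 f.
  by move=> x x'; rewrite hf hk.
have [U1 [Us [u1 us hUs]]] := IH k1 (fun x => f x \o query_map (inp x)) hq hk1 hg.
exists U, [tuple of U1 :: Us]; split=> // [j|x].
  by case: (unliftP ord0 j) => [j'|] ->; rewrite ?tnthS ?tnth0.
by rewrite /= hU oracle_real_vec.
Qed.

Lemma queries_diag T k k' x : queries inp T k k' -> k' x x = k x x.
Proof.
elim: T k => [|T IH] k /=; first by move->.
move=> [k1 [k0 [ki [_ _ e e']]] /IH ->]; rewrite e e'; congr (_ + _).
apply: eq_bigr => i _; rewrite /phase -expr2 sqrr_sign mulr1 //.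
Qed.

(** The extra last qubit stores [y x]; it makes states with different values orthogonal, as [k]
    already prescribes. *)
Lemma flag_state w k (y : X -> bool) : gram_tuple w k ->
  (forall x x', y x != y x' -> k x x' = 0) ->
  exists g : X -> basis N w.+1 -> R,
    (forall x x', \sum_b g x b * g x' b = k x x') /\
    (forall x b, rightmost_bit b != y x -> g x b = 0).
Proof.
move=> [a ha] hk.
pose e c (t : w.-tuple bool) : basis N w.+1 := (i0, false, [tuple of rcons t c]).
pose g x b := \sum_t a t x * (b == e (y x) t)%:R.
exists g; split=> [x x'|x b hb]; last first.
  apply: big1 => t _; case: eqP => [eb|]; last by rewrite mulr0.
  by rewrite eb /rightmost_bit /= last_rcons eqxx in hb.
transitivity (\sum_t \sum_t' a t x * a t' x' * (e (y x) t == e (y x') t')%:R).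
  under eq_bigr => b _ do rewrite mulr_suml; rewrite exchange_big /=.
  apply: eq_bigr => t _; under eq_bigr => b _ do rewrite mulr_sumr.
  rewrite exchange_big /=; apply: eq_bigr => t' _.
  rewrite (bigD1 (e (y x) t)) //= eqxx mulr1 big1 ?addr0 ?mulrA // => b /negPf ->.
  by rewrite mulr0 mul0r.
have eE t t' : (e (y x) t == e (y x') t') = (y x == y x') && (t == t').
  apply/eqP/andP => [[/rcons_inj[/val_inj -> ->]]|[/eqP -> /eqP -> //]].
  by rewrite !eqxx.
have [yy|ny] := eqVneq (y x) (y x'); last first.
  rewrite hk //; apply: big1 => t _; apply: big1 => t' _.
  by rewrite eE (negPf ny) mulr0.
rewrite ha; apply: eq_bigr => t _; rewrite (bigD1 t) //= big1 ?addr0 => [|t' ne].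
  by rewrite eE yy !eqxx mulr1.
by rewrite eE [t == t']eq_sym (negPf ne) andbF mulr0.
Qed.

Definition zero_basis w : basis N w := (i0, false, [tuple of nseq w false]).

Lemma is_zero_stateE w (s : basis N w) : i0 = 0%N :> nat ->
  is_zero_state s = (s == zero_basis w).
Proof.
case: s => [[i b] z] i00; rewrite /is_zero_state /zero_basis !xpair_eqE /=.
rewrite -i00 -(inj_eq val_inj) eqbF_neg -andbA; congr [&& _, _ & _].
rewrite -(inj_eq val_inj) /= -[X in nseq X _](size_tuple z).
have -> : all negb z = all (pred1 false) z by apply: eq_all => -[].
by apply/all_pred1P/eqP.
Qed.

Lemma computes_algorithm T (y : X -> bool) : i0 = 0%N :> nat ->
  computes (R := R) inp T y ->
  exists A : algorithm R N T, forall x, prob_accept A (inp x) = (y x)%:R.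
Proof.
move=> i00 [k hq hk].
have [w0 hw0] := queries_queries_tuple hq.
have [w1 hw1] := gram_gram_tuple (queries_gram gram1 hq).
pose w := maxn w0 w1.
have [g [hg hgy]] := flag_state (hw1 w (leq_maxr _ _)) hk.
pose f0 (x : X) (b : basis N w.+1) : R := (is_zero_state b)%:R.
have hf0 x x' : \sum_b f0 x b * f0 x' b = one_kernel x x'.
  rewrite (bigD1 (zero_basis w.+1)) //= /f0 is_zero_stateE // eqxx mulr1.
  by rewrite big1 ?addr0 // => b /negPf; rewrite is_zero_stateE // => ->; rewrite mulr0.
have [U0 [Us [u0 us hU]]] := queries_gates (hw0 w.+1 (leqW (leq_maxl _ _))) hf0 hg.
exists (Algorithm u0 us) => x.
have fin : final_state (Algorithm u0 us) (inp x) = real_vec (g x).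
  rewrite -hU /final_state /=; congr (foldl _ (_ *m _) _).
  by apply/colP => s; rewrite !mxE /f0; case: is_zero_state.
rewrite /prob_accept fin /=.
transitivity (\sum_(b : basis N w.+1 | rightmost_bit b) g x b * g x b).
  rewrite big_mkcond [RHS]big_mkcond -sum_basis; apply: eq_bigr => s _.
  by case: ifP => // _; rewrite mxE /= expr0n addr0 sqrtr_sqr real_normK ?num_real // expr2.
case: (boolP (y x)) => yx.
  (* Queries preserve norms, so the accepting states carry total weight 1. *)
  rewrite -[RHS](_ : \sum_b g x b * g x b = 1); last first.
    by rewrite hg (queries_diag x hq).
  rewrite big_mkcond; apply: eq_bigr => b _; case: ifP => // rb.
  by rewrite hgy ?mulr0 // rb yx.
by apply: big1 => b rb; rewrite hgy ?mulr0 // rb (negPf yx).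
Qed.

End StateConstruction.

(** * The AND-OR tree *)

Section StageSearch.
Context {R : realType} {N : nat} {X : Type} (inp : X -> input N).

Definition marked n (y : 'I_n -> X -> bool) x : {set 'I_n} := [set i | y i x].

(** [J] is chosen before [y] and [T], so the same count serves every block. *)
Lemma stages_onesided n (l : seq (stage n)) : all (@valid n) l ->
  exists2 J, (forall (y : 'I_n -> X -> bool) T,
      (forall i, flips (R := R) inp T (y i)) ->
      onesided (R := R) inp (J * T) (fun x => 0 < #|marked y x|)%N
        (fun x => has (fun st => hits st (marked y x)) l))
    & J%:R <= 3 * \sum_(st <- l) cost (R := R) st.
Proof.
elim: l => [_|st l IH] /=.
  by exists 0%N => [y T _|]; [exact: onesided0|rewrite big_nil mulr0].
move=> /andP[vst /IH[J2 h2 c2]].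
have [|J1 h1 c1] := @search_onesided R N X inp 'I_(pool st) (target st).
  by rewrite card_ord.
exists (J1 + J2)%N => [y T hy|]; last first.
  by move: c1; rewrite card_ord natrD big_cons mulrDr => c1; apply: lerD.
rewrite mulnDl; apply: onesidedD (h2 y T hy).
have -> : (fun x => hits st (marked y x))
    = (fun x => #|[pred r | y (@item n st r) x]| == target st).
  apply/funext => x; rewrite /hits; congr (_ == _); apply: eq_card => r.
  by rewrite !inE.
apply: h1 => // r x yx; apply/card_gt0P; exists (@item n st r).
by rewrite inE.
Qed.

Lemma stages_computes n (l : seq (stage n)) : all (@valid n) l ->
  exists2 J, (forall (y : 'I_n -> X -> bool) T,
      (forall i, flips (R := R) inp T (y i)) ->
      (forall x, (0 < #|marked y x|)%N -> ~~ uncovered l (marked y x)) ->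
      computes (R := R) inp (J * T) (fun x => 0 < #|marked y x|)%N)
    & J%:R <= 3 * \sum_(st <- l) cost (R := R) st.
Proof.
move=> /stages_onesided[J hJ cJ]; exists J => // y T hy hl.
by apply: onesided_computes (hJ y T hy) _ => x /hl; rewrite negbK.
Qed.

End StageSearch.

(** * Block structure, good inputs and the final algorithm *)

Section Blocks.
Context {m : nat}.
Implicit Types (x : input (m ^ 2)) (i j : 'I_m).

Lemma block_index_subproof i j : (j * m + i < m ^ 2)%N.
Proof. by have := ltn_ord i; have := ltn_ord j; rewrite expnS expn1; nia. Qed.

Definition block_index j i : 'I_(m ^ 2) := Ordinal (block_index_subproof i j).

Definition block x j : {set 'I_m} := [set i | x (block_index j i)].

Definition zero_blocks x : {set 'I_m} := [set j | ~~ (0 < #|block x j|)%N].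

Lemma AO_zero_blocks x : AO x = ~~ (0 < #|zero_blocks x|)%N.
Proof.
rewrite /AO -leqNgt leqn0 cards_eq0; apply/forallP/eqP => [h|h j].
  apply/setP => j; rewrite !inE; apply/negbTE; rewrite negbK.
  have /existsP[i /andP[/eqP ij xi]] := h j.
  have m0 : (0 < m)%N by case: (m) j {h ij} => // -[].
  apply/card_gt0P; exists (Ordinal (ltn_pmod i m0)); rewrite inE.
  by rewrite (_ : block_index _ _ = i) //; apply: val_inj; rewrite /= -ij -divn_eq.
have /setP/(_ j) := h; rewrite !inE => /negbT; rewrite negbK => /card_gt0P[k].
rewrite inE => xk; apply/existsP; exists (block_index j k).
by rewrite xk andbT /= divnMDl ?(leq_ltn_trans _ (ltn_ord k)) // divn_small ?addn0.
Qed.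

End Blocks.

Lemma sum_pushforward (R : realType) (I P : finType) (c : I -> R) (f : I -> P)
    (B : pred P) :
  \sum_(p | B p) \sum_i c i * (f i == p)%:R = \sum_i c i * (B (f i))%:R.
Proof.
rewrite exchange_big; apply: eq_bigr => i _ /=; rewrite -mulr_sumr; congr (_ * _).
rewrite big_mkcond (bigD1 (f i)) //= eqxx big1 ?addr0 => [|p /negPf ne].
  by case: (B _).
by rewrite eq_sym ne; case: ifP.
Qed.

(** Union bound: the expected number of nonzero blocks missed by [l1] is at most [m] / 2^L <= 1/8,
    and [l2] misses with probability at most 2^-3, leaving weight at least 3/4. *)
Lemma exists_good_stages (R : realType) m L (mu : input (m ^ 2) -> R) :
  is_distribution mu -> (8 * m <= 2 ^ L)%N -> (0 < L)%N ->
  exists l1 l2 : seq (stage m), [/\ all (@valid m) l1, all (@valid m) l2,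
    \sum_(st <- l1) cost (R := R) st <= 50 * Num.sqrt (m * L)%:R,
    \sum_(st <- l2) cost (R := R) st <= 50 * Num.sqrt (m * 3)%:R &
    2 / 3 <= \sum_(x | [forall j, (0 < #|block x j|)%N ==> ~~ uncovered l1 (block x j)]
       && ((0 < #|zero_blocks x|)%N ==> ~~ uncovered l2 (zero_blocks x))) mu x].
Proof.
move=> [mu0 mu1] hL L0.
(* All [m] blocks of an input are counted, so [nu1] has total mass [m]. *)
pose nu1 p := \sum_(u : input (m ^ 2) * 'I_m) mu u.1 * (block u.1 u.2 == p)%:R.
pose nu2 q := \sum_x mu x * (zero_blocks x == q)%:R.
have nu1_ge0 p : 0 <= nu1 p by apply: sumr_ge0 => u _; rewrite mulr_ge0.
have nu2_ge0 p : 0 <= nu2 p by apply: sumr_ge0 => u _; rewrite mulr_ge0.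
have [l1 [v1 c1 h1]] := covering L0 nu1_ge0.
have [l2 [v2 c2 h2]] := covering (isT : (0 < 3)%N) nu2_ge0.
exists l1, l2; split=> //.
have e2 : \sum_p nu2 p = 1.
  by rewrite sum_pushforward -[RHS]mu1; apply: eq_bigr => x _; rewrite mulr1.
have e1 : \sum_p nu1 p = m%:R.
  rewrite sum_pushforward -(pair_bigA _ (fun x (j : 'I_m) => mu x * 1)) /=.
  under eq_bigr => x _ do rewrite sumr_const card_ord mulr1.
  by rewrite sumrMnl mu1.
move: h1 h2; rewrite e1 e2 !sum_pushforward.
set bad1 := \sum_i _; set bad2 := \sum_i _.
move=> h1 h2; pose good x := [forall j, (0 < #|block x j|)%N ==> ~~ uncovered l1 (block x j)]
  && ((0 < #|zero_blocks x|)%N ==> ~~ uncovered l2 (zero_blocks x)).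
change (2 / 3 <= \sum_(x | good x) mu x).
have hsum : 1 <= \sum_(x | good x) mu x + bad1 + bad2.
  rewrite -mu1 [\sum_(x | good x) _]big_mkcond /bad1.
  rewrite -(pair_bigA _ (fun x j => mu x *
    ((0 < #|block x j|)%N && uncovered l1 (block x j))%:R)) /=.
  rewrite /bad2 -!big_split /=; apply: ler_sum => x _.
  have s0 : 0 <= \sum_j mu x * ((0 < #|block x j|)%N && uncovered l1 (block x j))%:R.
    by apply: sumr_ge0 => j _; rewrite mulr_ge0.
  have t0 b : 0 <= mu x * (b : bool)%:R by rewrite mulr_ge0.
  case: (boolP (good x)) => [_|]; first by rewrite -addrA lerDl addr_ge0.
  rewrite negb_and => /orP[].
    rewrite negb_forall => /existsP[j]; rewrite negb_imply negbK => hj.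
    rewrite add0r (bigD1 j) //= hj mulr1 -addrA lerDl addr_ge0 //.
    by apply: sumr_ge0 => *; rewrite mulr_ge0.
  by rewrite negb_imply negbK => ->; rewrite add0r mulr1 lerDr.
have : 2^-1 ^+ L * m%:R <= 8^-1 :> R.
  rewrite exprVn mulrC ler_pdivrMr ?exprn_gt0 // mulrC ler_pdivlMr // -natrX -natrM ler_nat.
  by rewrite mulnC.
have e8 : (2^-1 : R) ^+ 3 = 8^-1 by field.
move: h1 h2 hsum; rewrite e8; lra.
Qed.

Lemma AO_algorithm (R : realType) m L (mu : input (m ^ 2) -> R) :
  is_distribution mu -> (0 < m)%N -> (8 * m <= 2 ^ L)%N -> (0 < L)%N ->
  exists T (A : algorithm R (m ^ 2) T), weakly_exact A mu (@AO m) /\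
    T%:R <= 300 ^+ 2 * (m%:R * Num.sqrt L%:R) :> R.
Proof.
move=> hmu m0 hL L0; have [mu0 mu1] := hmu.
have [l1 [l2 [v1 v2 c1 c2 hgood]]] := exists_good_stages hmu hL L0.
set good := (X in \sum_(x | X x) _) in hgood.
(* Restricted to the subtype of good inputs, every search is exact. *)
pose inp (x : {x | good x}) := val x.
have [J1 h1 b1] := stages_computes (R := R) inp v1.
have [J2 h2 b2] := stages_computes (R := R) inp v2.
(* The doubling pays for uncomputing the OR. *)
have inner j : flips (R := R) inp (J1 * 1).*2 (fun x => ~~ (0 < #|block (inp x) j|)%N).
  apply/flips_neg/computes_flips.
  apply: (h1 (fun i x => inp x (block_index j i)) 1%N) => [i|x hx].
    exact: flips_input.
  have /andP[/forallP/(_ j)/implyP + _] := valP x; exact.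
have outer : computes (R := R) inp (J2 * (J1 * 1).*2) (fun x => 0 < #|zero_blocks (inp x)|)%N.
  apply: (h2 (fun j x => ~~ (0 < #|block (inp x) j|)%N)) => [//|x hx].
  have /andP[_ /implyP] := valP x; exact.
have i00 : (0 < m ^ 2)%N by rewrite expn_gt0 m0.
have [|A hA] := @computes_algorithm R (m ^ 2) (Ordinal i00) _ inp
   (J2 * (J1 * 1).*2) (fun x => AO (inp x)) erefl.
  have [k hk k0] := outer; exists k => // x x'; rewrite !AO_zero_blocks.
  by rewrite (inj_eq negb_inj); apply: k0.
exists (J2 * (J1 * 1).*2)%N, A; split.
  apply: le_trans hgood _; apply: ler_sum_pred => // x gx.
  by have := hA (Sub x gx); rewrite /inp SubK => ->.
rewrite muln1 natrM -mul2n natrM.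
have sm : Num.sqrt m%:R * Num.sqrt m%:R = m%:R :> R by rewrite -expr2 sqr_sqrtr.
have s3 : Num.sqrt 3 <= 2 :> R.
  by rewrite -[leRHS]ger0_norm // -sqrtr_sqr ler_sqrt ?sqr_ge0 //; lra.
(* 3 * 50 * sqrt 3 <= 300. *)
have j2 : J2%:R <= 300 * Num.sqrt m%:R :> R.
  move: c2; rewrite natrM sqrtrM //; have := sqrtr_ge0 (m%:R : R); nra.
have j1 : J1%:R <= 150 * (Num.sqrt m%:R * Num.sqrt L%:R) :> R.
  by move: c1; rewrite natrM sqrtrM //; lra.
have j1' : 2 * J1%:R <= 300 * (Num.sqrt m%:R * Num.sqrt L%:R) :> R by lra.
apply: le_trans (ler_pM _ _ j2 j1') _ => //.
by rewrite -[m%:R in leRHS]sm le_eqVlt; apply/orP; left; apply/eqP; ring.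
Qed.

Theorem theorem4 (R : realType) :
  exists (C : R) (N0 : nat), 0 < C /\
    forall (m : nat), (N0 <= m ^ 2)%N ->
    forall (mu : {ffun 'I_(m ^ 2) -> bool} -> R), is_distribution mu ->
      (QWE mu (@AO m)
         <= (C * Num.sqrt ((m ^ 2)%N%:R * ln (m ^ 2)%N%:R))%:E)%E.
Proof.
have ln2 : 0 < ln 2 :> R by rewrite ln_gt0 // ltr1n.
(* For [m >= 2], ensured by the threshold 4 on [m ^ 2], the choice L = u + 3 = (u - 1) + 4 is at
   most 5 ln m / ln 2. *)
pose K : R := 5 / ln 2; have K0 : 0 < K by rewrite divr_gt0.
exists (300 ^+ 2 * Num.sqrt K), 4%N; split; first by rewrite mulr_gt0 // sqrtr_gt0.
move=> m hm mu hmu.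
have m1 : (1 < m)%N by case: m hm {mu hmu} => [|[]].
have m0 : (0 < m)%N by apply: ltnW.
have [um mu2] : (2 ^ (up_log 2 m).-1 < m)%N /\ (m <= 2 ^ up_log 2 m)%N.
  by apply/andP; apply: up_log_bounds.
set u := up_log 2 m in um mu2 *.
have u0 : (0 < u)%N by rewrite up_log_gt0.
have hL : (8 * m <= 2 ^ (u + 3))%N by rewrite expnD mulnC leq_mul2r mu2 orbT.
have L0 : (0 < u + 3)%N by rewrite addn_gt0 u0.
have [T [A [wA hT]]] := AO_algorithm hmu m0 hL L0.
apply: le_trans (_ : ((T%:R : R)%:E <= _)%E).
  by apply: ereal_inf_lbound; exists T => //; exists A.
rewrite lee_fin; apply: le_trans hT _.
rewrite -[leRHS]mulrA; apply: ler_wpM2l; first by rewrite exprn_ge0.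
rewrite natrX (sqrtrM _ (sqr_ge0 _)) sqrtr_sqr ger0_norm //.
rewrite [leRHS]mulrCA ler_wpM2l // -(sqrtrM _ (ltW K0)) ler_sqrt; last first.
  by apply: mulr_ge0; [exact: ltW|rewrite ln_ge0 // -natrX ler1n expn_gt0 m0].
have mR : 0 < m%:R :> R by rewrite ltr0n.
rewrite lnXn // /K mulrAC ler_pdivlMr //.
have hlu : u.-1%:R * ln 2 <= ln m%:R :> R.
  rewrite mulr_natl -lnXn // -natrX ler_ln ?posrE ?ltr0n ?expn_gt0 //.
  by rewrite ler_nat ltnW.
have hl2 : ln 2 <= ln m%:R :> R by rewrite ler_ln ?posrE // ler_nat.
have -> : (u + 3)%:R = u.-1%:R + 4 :> R by rewrite -natrD; congr _%:R; lia.
rewrite mulr2n; lra.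
Qed.
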